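(* Let $R$ be a ring. (i) If $R$ is not an Artinian principal ideal ring, then there exists an uncountable set of distinct associate classes in $R[[x]]$. (ii) In particular, if $R$ is countable and not an Artinian principal ideal ring, then there exists an uncountable set of distinct associate classes in $R[[x]]$, none of which contains a polynomial (i.e. an element of $R[x]$). (iii) Moreover, if $R$ is an Artinian principal ideal ring, then every element of $R[[x]]$ is associate to a polynomial in $R[x]$.
   Context: All rings are commutative with a nonzero identity. For a ring $A$ with unit group $A^\times$, the associate class of $r\in A$ is $A^\times r=\{ur: u\in A^\times\}$, and $r$ is associate to $r'$ in $A$ if $r\in r'A^\times$. Here $A=R[[x]]$. A principal ideal ring is a ring in which every ideal is principal (it need not be a domain). *)

(* Defs.v *)
From HB Require Import structures.
From mathcomp Require Import all_boot all_order all_algebra.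
From mathcomp Require Import boolp classical_sets functions cardinality.

Set Implicit Arguments.
Unset Strict Implicit.
Unset Printing Implicit Defensive.

Import GRing.Theory.

Local Open Scope classical_set_scope.
Local Open Scope ring_scope.

(* [FPS a] is the formal power series \sum_i (a i) x^i. *)
Record fps (R : Type) : Type := FPS { fps_coef : nat -> R }.

Section FormalPowerSeries.
Variable R : comNzRingType.
Implicit Types (f g h : fps R) (p q : {poly R}).

HB.instance Definition _ := gen_eqMixin (fps R).
HB.instance Definition _ := gen_choiceMixin (fps R).

Lemma fpsP f g : (forall i, fps_coef f i = fps_coef g i) -> f = g.
Proof. by case: f g => [a] [b] /= /funext ->. Qed.

Definition fps_zero : fps R := FPS (fun=> 0).
Definition fps_opp f : fps R := FPS (fun i => - fps_coef f i).
Definition fps_add f g : fps R := FPS (fun i => fps_coef f i + fps_coef g i).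
Definition fps_one : fps R := FPS (fun i => (i == 0%N)%:R).
Definition fps_mul f g : fps R :=
  FPS (fun i => \sum_(j < i.+1) fps_coef f j * fps_coef g (i - j)).

Fact fps_addA : associative fps_add.
Proof. by move=> f g h; apply: fpsP => i /=; rewrite addrA. Qed.

Fact fps_addC : commutative fps_add.
Proof. by move=> f g; apply: fpsP => i /=; rewrite addrC. Qed.

Fact fps_add0 : left_id fps_zero fps_add.
Proof. by move=> f; apply: fpsP => i /=; rewrite add0r. Qed.

Fact fps_addN : left_inverse fps_zero fps_opp fps_add.
Proof. by move=> f; apply: fpsP => i /=; rewrite addNr. Qed.

HB.instance Definition _ :=
  GRing.isZmodule.Build (fps R) fps_addA fps_addC fps_add0 fps_addN.

(* The multiplicative ring axioms are transferred from {poly R}, a series and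
   its truncations having the same low-degree coefficients. *)
Let trunc n f : {poly R} := \poly_(i < n) fps_coef f i.

Let coef_trunc n f i : (i < n)%N -> (trunc n f)`_i = fps_coef f i.
Proof. by move=> ltin; rewrite coef_poly ltin. Qed.

Let coef_mul p q f g n :
  (forall i, (i < n)%N -> p`_i = fps_coef f i) ->
  (forall i, (i < n)%N -> q`_i = fps_coef g i) ->
  forall i, (i < n)%N -> (p * q)`_i = fps_coef (fps_mul f g) i.
Proof.
move=> pf qg i ltin; rewrite coefM /=; apply: eq_bigr => j _.
by rewrite pf ?qg // (leq_ltn_trans _ ltin) ?leq_subr ?leq_ord.
Qed.

Fact fps_mulA : associative fps_mul.
Proof.
move=> f g h; apply: fpsP => i; have tr := @coef_trunc i.+1.
rewrite -(coef_mul (tr f) (coef_mul (tr g) (tr h))) //.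
by rewrite -(coef_mul (coef_mul (tr f) (tr g)) (tr h)) // mulrA.
Qed.

Fact fps_mulC : commutative fps_mul.
Proof.
move=> f g; apply: fpsP => i; have tr := @coef_trunc i.+1.
by rewrite -(coef_mul (tr f) (tr g)) // -(coef_mul (tr g) (tr f)) // mulrC.
Qed.

Fact fps_mul1 : left_id fps_one fps_mul.
Proof.
move=> f; apply: fpsP => i; have tr := @coef_trunc i.+1.
rewrite -(coef_mul (p := 1) _ (tr f) (ltnSn i)) ?mul1r ?tr //.
by move=> j _; rewrite coef1.
Qed.

Fact fps_mulDl : left_distributive fps_mul +%R.
Proof.
move=> f g h; apply: fpsP => i /=; rewrite -big_split /=.
by apply: eq_bigr => j _; rewrite mulrDl.
Qed.

Fact fps_one_neq0 : fps_one != 0.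
Proof.
apply/eqP => /(congr1 (fun f => fps_coef f 0)) /= /eqP.
by rewrite oner_eq0.
Qed.

HB.instance Definition _ := GRing.Zmodule_isComNzRing.Build (fps R)
  fps_mulA fps_mulC fps_mul1 fps_mulDl fps_one_neq0.

(* The invertible series, decided classically; as everywhere in MathComp, the
   inverse is extended by the identity to non-units. *)
Definition fps_unit : {pred fps R} := fun f => `[< exists g, g * f = 1 >].
Definition fps_inv f : fps R :=
  if pselect (exists g, g * f = 1) is left invf then projT1 (cid invf) else f.

Fact fps_mulVx : {in fps_unit, left_inverse 1 fps_inv *%R}.
Proof.
move=> f /asboolP invf; rewrite /fps_inv; case: pselect => // invf'.
exact: (projT2 (cid invf')).
Qed.

Fact fps_unitPl f g : g * f = 1 -> fps_unit f.
Proof. by move=> gf1; apply/asboolP; exists g. Qed.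

Fact fps_inv_out : {in [predC fps_unit], fps_inv =1 id}.
Proof.
move=> f /asboolPn Ninvf; rewrite /fps_inv; by case: pselect.
Qed.

HB.instance Definition _ := GRing.ComNzRing_hasMulInverse.Build (fps R)
  fps_mulVx fps_unitPl fps_inv_out.

Definition fps_of_poly p : fps R := FPS (fun i => p`_i).

End FormalPowerSeries.

Section Associates.
Variable A : comUnitRingType.

Definition associate_class (r : A) : set A :=
  [set u * r | u in [set u : A | u \is a GRing.unit]].

Definition associate (r r' : A) : Prop := associate_class r' r.

Definition associate_classes : set (set A) := range associate_class.

End Associates.

Arguments associate_classes : clear implicits.

Section Ideals.
Variable R : comNzRingType.

(* Unlike MathComp's [idealr], the unit ideal is allowed. *)
Definition ideal (I : set R) : Prop :=
  [/\ I 0, (forall a b, I a -> I b -> I (a + b))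
    & (forall r a, I a -> I (r * a))].

Definition principal_ideal (a : R) : set R := [set r * a | r in setT].

End Ideals.

Definition principal_ideal_ring (R : comNzRingType) : Prop :=
  forall I : set R, ideal I -> exists a, I = principal_ideal a.

Definition artinian (R : comNzRingType) : Prop :=
  forall I : nat -> set R,
    (forall n, ideal (I n)) -> (forall n, I n.+1 `<=` I n) ->
  exists N, forall n, (N <= n)%N -> I n = I N.

Definition artinian_pir (R : comNzRingType) : Prop :=
  artinian R /\ principal_ideal_ring R.

(* Main.v *)
(** The non-Artinian-PIR case splits into three situations, each giving a
    family of series indexed by 0-1 sequences (s_n), no two of them associate:
    - an infinite ascending chain of ideals with a_n in I_(n+1) \ I_n gives
      \sum_n s_n a_n x^n, because a unit multiple has the same ideals of
      initial coefficients;
    - if (b : a) + (a : b) is contained in a proper ideal M, then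
      u (a + b s) = a + b s' forces u = 1 and s = s' modulo M;
    - if t is a non-zero-divisor and a non-unit modulo I, then
      u (t - x s) = t - x s' forces s = s', because x is regular modulo I and
      t - x s, and x^k is not a multiple of t - x s modulo I.
    If none of them occurs, R is Noetherian, the ideals (0 : b^n) show that R
    is strongly pi-regular, idempotents make two-generated ideals principal,
    and Noetherian induction makes R Artinian.
    Conversely, over an Artinian principal ideal ring f = c g with g of content
    1, idempotents reduce to the case where some coefficient of g is a unit
    and the previous ones are nilpotent, and Weierstrass preparation applies. *)

Require Import Defs.
From mathcomp Require Import all_boot all_order all_algebra ring.
From mathcomp Require Import boolp classical_sets functions cardinality.

Set Implicit Arguments.
Unset Strict Implicit.
Unset Printing Implicit Defensive.

Import GRing.Theory.

Local Open Scope classical_set_scope.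
Local Open Scope ring_scope.

(** * Nilpotent elements *)

Definition nilpotent (R : comNzRingType) (a : R) : Prop :=
  exists n, a ^+ n = 0.

Lemma nilpotent0 (R : comNzRingType) : nilpotent (0 : R).
Proof. by exists 1%N; rewrite expr1. Qed.

Lemma nilpotentM (R : comNzRingType) (a b : R) :
  nilpotent b -> nilpotent (a * b).
Proof. by case=> n bn0; exists n; rewrite exprMn bn0 mulr0. Qed.

Lemma nilpotentD (R : comNzRingType) (a b : R) :
  nilpotent a -> nilpotent b -> nilpotent (a + b).
Proof.
case=> m am0 [n bn0]; exists (m + n)%N.
rewrite exprDn big1 // => i _.
have [lein|ltni] := leqP n i.
  by rewrite -(subnK lein) exprD bn0 !mulr0 mul0rn.
rewrite -(subnK (_ : (m <= m + n - i)%N)); last first.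
  by rewrite -addnBA ?leq_addr // ltnW.
by rewrite exprD am0 mulr0 mul0r mul0rn.
Qed.

Lemma nilpotent_sum (R : comNzRingType) n (F : 'I_n -> R) :
  (forall i, nilpotent (F i)) -> nilpotent (\sum_i F i).
Proof.
move=> nilF; apply: big_ind => [||i _]; [exact: nilpotent0| |exact: nilF].
exact: nilpotentD.
Qed.

Lemma subr1_nilpotent (R : comNzRingType) (a : R) :
  nilpotent a -> exists b, (1 - a) * b = 1.
Proof.
case=> n an0; exists (\sum_(i < n) a ^+ i).
by rewrite -opprB mulNr -subrX1 an0 sub0r opprK.
Qed.

Lemma nilpotent_idem_eq0 (R : comNzRingType) (e : R) :
  e * e = e -> nilpotent e -> e = 0.
Proof.
move=> ee [n]; case: n => [/eqP|n]; first by rewrite oner_eq0.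
suff -> : e ^+ n.+1 = e by [].
by elim: n => // n IHn; rewrite exprS IHn.
Qed.

(* If U is onto, every f is approximated by U + c T up to a multiple of c,
   and the error can be pushed into higher and higher powers of c. *)
Lemma nilpotent_perturbation_onto (A : comNzRingType) (U T : A -> A) (c : A) :
    {morph U : x y / x + y} -> {morph T : x y / x + y} ->
    (forall x, U (c * x) = c * U x) -> (forall x, T (c * x) = c * T x) ->
    nilpotent c -> (forall f, exists q, U q = f) ->
  forall f, exists q, U q + c * T q = f.
Proof.
move=> UD TD Uc Tc [n cn0] ontoU f.
have Ucn j x : U (c ^+ j * x) = c ^+ j * U x.
  by elim: j => [|j IHj]; rewrite ?mul1r // exprS -!mulrA Uc IHj.
have Tcn j x : T (c ^+ j * x) = c ^+ j * T x.
  by elim: j => [|j IHj]; rewrite ?mul1r // exprS -!mulrA Tc IHj.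
have [q [r def_f]] : exists q r, f = U q + c * T q + c ^+ n * r.
  elim: n {cn0} => [|n [q [r def_f]]].
    have [q Uq] := ontoU f; exists q, (- (c * T q)).
    by rewrite mul1r Uq addrK.
  have [s Us] := ontoU r; exists (q + c ^+ n * s), (- T s).
  by rewrite def_f UD TD Ucn Tcn Us exprS; ring.
by exists q; rewrite [RHS]def_f cn0 mul0r addr0.
Qed.

(** * Formal power series *)

Definition fps_const (R : comNzRingType) (a : R) : fps R :=
  fps_of_poly a%:P.

Section FpsTheory.
Variable R : comNzRingType.
Implicit Types (f g h : fps R) (a c e : R).

Local Notation C := (@fps_const R).

Lemma fps_coefD f g i : fps_coef (f + g) i = fps_coef f i + fps_coef g i.
Proof. by []. Qed.

Lemma fps_coefN f i : fps_coef (- f) i = - fps_coef f i.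
Proof. by []. Qed.

Lemma fps_coefM f g i :
  fps_coef (f * g) i = \sum_(j < i.+1) fps_coef f j * fps_coef g (i - j).
Proof. by []. Qed.

Lemma fps_coef1 i : fps_coef (1 : fps R) i = (i == 0%N)%:R.
Proof. by []. Qed.

Lemma fps_coef_sum n (F : 'I_n -> fps R) i :
  fps_coef (\sum_j F j) i = \sum_j fps_coef (F j) i.
Proof.
by apply: (big_morph (fun f => fps_coef f i)).
Qed.

Lemma fps_coefC a i : fps_coef (C a) i = if i == 0%N then a else 0.
Proof. by rewrite /= coefC. Qed.

Lemma fps_coefCM a f i : fps_coef (C a * f) i = a * fps_coef f i.
Proof.
rewrite fps_coefM big_ord_recl fps_coefC subn0 big1 ?addr0 // => j _.
by rewrite fps_coefC mul0r.
Qed.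

Lemma fps_const1 : C 1 = 1.
Proof. by apply: fpsP => i; rewrite fps_coefC fps_coef1; case: eqP. Qed.

Lemma fps_constM : {morph C : a c / a * c}.
Proof.
move=> a c; apply: fpsP => i; rewrite fps_coefCM !fps_coefC.
by case: eqP; rewrite ?mulr0.
Qed.

Lemma fps_constD : {morph C : a c / a + c}.
Proof.
move=> a c; apply: fpsP => i; rewrite fps_coefD !fps_coefC.
by case: eqP; rewrite ?addr0.
Qed.

Lemma fps_of_polyZD a c (p q : {poly R}) :
  fps_of_poly (a *: p + c *: q) = C a * fps_of_poly p + C c * fps_of_poly q.
Proof.
by apply: fpsP => i; rewrite fps_coefD !fps_coefCM /= coefD !coefZ.
Qed.

Lemma fps_of_polyZ a (p : {poly R}) :
  fps_of_poly (a *: p) = C a * fps_of_poly p.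
Proof. by apply: fpsP => i; rewrite fps_coefCM /= coefZ. Qed.

Lemma fps_poly_of_finite f n :
  (forall i, (n <= i)%N -> fps_coef f i = 0) ->
  f = fps_of_poly (\poly_(i < n) fps_coef f i).
Proof.
move=> f0; apply: fpsP => i /=; rewrite coef_poly.
by case: ltnP => // /f0.
Qed.

Lemma fps_coef_exp_eq0 f n i :
  fps_coef f 0 = 0 -> (i < n)%N -> fps_coef (f ^+ n) i = 0.
Proof.
move=> f00; elim: n i => // n IHn i; rewrite ltnS => lein.
rewrite exprS fps_coefM big_ord_recl f00 mul0r add0r big1 // => j _.
rewrite IHn ?mulr0 // lift0.
case: i j lein => [[]|i j lein] //.
by rewrite subSS (leq_ltn_trans (leq_subr _ _)).
Qed.

(* The inverse is the x-adic limit of the partial sums of \sum_i (1 - f)^i. *)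
Lemma fps_unit_of_coef0_eq1 f :
  fps_coef f 0 = 1 -> exists g, f * g = 1.
Proof.
move=> f01; pose y := 1 - f; pose G n := \sum_(i < n) y ^+ i.
have y00 : fps_coef y 0 = 0 by rewrite fps_coefD fps_coefN f01 subrr.
have stable n i : (i < n)%N -> fps_coef (G n) i = fps_coef (G i.+1) i.
  elim: n => // n IHn; rewrite ltnS leq_eqVlt => /predU1P[-> //|ltin].
  by rewrite /G big_ord_recr fps_coefD fps_coef_exp_eq0 // addr0 -IHn.
exists (FPS (fun i => fps_coef (G i.+1) i)); apply: fpsP => i.
have -> : fps_coef (f * FPS (fun i => fps_coef (G i.+1) i)) i =
          fps_coef (f * G i.+1) i.
  rewrite !fps_coefM; apply: eq_bigr => j _ /=.
  by rewrite [in RHS]stable // ltnS leq_subr.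
have -> : f * G i.+1 = 1 - y ^+ i.+1.
  by rewrite -[RHS]opprB subrX1 -mulNr /y; congr (_ * _); ring.
by rewrite fps_coefD fps_coefN fps_coef_exp_eq0 // subr0.
Qed.

Lemma fps_unit_of_coef0 f a : fps_coef f 0 * a = 1 -> exists g, f * g = 1.
Proof.
move=> f0a; have [|g fg1] := @fps_unit_of_coef0_eq1 (C a * f).
  by rewrite fps_coefCM mulrC.
by exists (C a * g); rewrite mulrCA mulrA.
Qed.

(** * Weierstrass preparation *)

(* Solves q f = x^k + (terms of degree < k) for q: setting Q := q h where h is
   f stripped of its first k terms, this reads Q + \sum_(i < k) f_i T_i Q = 1
   with linear T_i, which is solvable as all these f_i are nilpotent. *)
Lemma weierstrass_preparation f k :
    (forall i, (i < k)%N -> nilpotent (fps_coef f i)) ->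
    (exists c, fps_coef f k * c = 1) ->
  exists u v p, u * v = 1 /\ f = u * fps_of_poly p.
Proof.
move=> nilf [c fkc]; pose h : fps R := FPS (fun i => fps_coef f (i + k)).
have [h' hh'] : exists h', h * h' = 1 by apply: (@fps_unit_of_coef0 _ c).
pose T i Q : fps R := FPS (fun n => fps_coef (h' * Q) (n + k - i)).
have TD i : {morph T i : x y / x + y}.
  by move=> x y; apply: fpsP => n; rewrite /T mulrDr.
have TC i a x : T i (C a * x) = C a * T i x.
  apply: fpsP => n; rewrite fps_coefCM /T mulrCA.
  exact: (fps_coefCM a (h' * x) (n + k - i)).
pose U j Q := Q + \sum_(i < j) C (fps_coef f i) * T i Q.
have UD j : {morph U j : x y / x + y}.
  move=> x y; rewrite /U addrACA -big_split; congr (_ + _).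
  by apply: eq_bigr => i _; rewrite TD mulrDr.
have UC j a x : U j (C a * x) = C a * U j x.
  rewrite /U mulrDr mulr_sumr; congr (_ + _).
  by apply: eq_bigr => i _; rewrite TC mulrCA.
(* Starting from [U 0 = id], one nilpotent perturbation is added at a time. *)
have ontoU j : (j <= k)%N -> forall g, exists Q, U j Q = g.
  elim: j => [_ g|j IHj ltjk g]; first by exists g; rewrite /U big_ord0 addr0.
  have [] := @nilpotent_perturbation_onto _ (U j) (T j) (C (fps_coef f j))
    (UD j) (TD j) (UC j _) (TC j _) _ (IHj (ltnW ltjk)) g.
    have [n fjn] := nilf j ltjk; exists n.
    have -> : C (fps_coef f j) ^+ n = C (fps_coef f j ^+ n).
      elim: (n) => [|m IHm]; first by rewrite fps_const1.
      by rewrite !exprS IHm fps_constM.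
    by rewrite fjn; apply: fpsP => i; rewrite fps_coefC; case: eqP.
  by move=> Q <-; exists Q; rewrite /U big_ord_recr /= addrA.
have [Q UQ] := ontoU k (leqnn k) 1; pose q := h' * Q.
have [Q' QQ'] : exists Q', Q * Q' = 1.
  pose s := \sum_(i < k) C (fps_coef f i) * T i Q.
  have [|b sb] := @subr1_nilpotent _ (fps_coef s 0).
    rewrite fps_coef_sum; apply: nilpotent_sum => i.
    by rewrite fps_coefCM mulrC; apply/nilpotentM/nilf.
  apply: (@fps_unit_of_coef0 _ b); rewrite -[RHS]sb; congr (_ * _).
  have -> : Q = 1 - s by rewrite -UQ /U addrK.
  by rewrite fps_coefD fps_coefN.
have qf n : fps_coef (q * f) (n + k) = (n == 0%N)%:R.
  rewrite -fps_coef1 -UQ /U fps_coefD fps_coef_sum mulrC fps_coefM.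
  rewrite -addSn addnC big_split_ord addrC; congr (_ + _); last first.
    have -> : Q = h * q by rewrite /q mulrA hh' mul1r.
    rewrite fps_coefM; apply: eq_bigr => i _.
    by rewrite [rshift k i : nat]addnC subnDr.
  by apply: eq_bigr => i _; rewrite fps_coefCM.
exists (h * Q'), q, (\poly_(i < k.+1) fps_coef (q * f) i).
have uq : h * Q' * q = 1.
  by rewrite mulrACA hh' mul1r mulrC.
split=> //; rewrite -fps_poly_of_finite; first by rewrite mulrA uq mul1r.
by move=> i ltki; rewrite -(subnK (ltnW ltki)) qf eqn0Ngt subn_gt0 ltki.
Qed.

End FpsTheory.

(** * Artinian principal ideal rings *)

Lemma ideal_principal (R : comNzRingType) (t : R) : ideal (principal_ideal t).
Proof.
split=> [|_ _ [r _ <-] [s _ <-]|s _ [r _ <-]].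
- by exists 0; rewrite ?mul0r.
- by exists (r + s); rewrite ?mulrDl.
- by exists (s * r); rewrite ?mulrA.
Qed.

Lemma principal_ideal_refl (R : comNzRingType) (t : R) : principal_ideal t t.
Proof. by exists 1; rewrite ?mul1r. Qed.

(** With [e = s * b], this makes [b] a unit in the summand [eR] and nilpotent in [(1 - e)R]. *)
Definition idempotent_splitting (R : comNzRingType) (b : R) : Prop :=
  exists s, s * b * (s * b) = s * b /\ nilpotent ((1 - s * b) * b).

(** The idempotent is [e = r ^+ n.+1 * b ^+ n.+1]: iterating the hypothesis gives
    [b ^+ n.+1 = e * b ^+ n.+1], so [e] is idempotent and [(1 - e) * b] is nilpotent. *)
Lemma pi_regular_splitting (R : comNzRingType) (b r : R) n :
  b ^+ n = r * b ^+ n.+1 -> idempotent_splitting b.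
Proof.
move=> bn; have bnj j : b ^+ n = r ^+ j * b ^+ (n + j).
  elim: j => [|j IHj]; first by rewrite mul1r addn0.
  rewrite {1}IHj [(n + j)%N]addnC exprD bn -addSnnS exprD [r ^+ j.+1]exprS.
  by ring.
have bN : b ^+ n.+1 = r ^+ n.+1 * b ^+ n.+1 * b ^+ n.+1.
  by rewrite {1}exprS {1}(bnj n.+1) exprD !exprS; ring.
exists (r ^+ n.+1 * b ^+ n).
have -> : r ^+ n.+1 * b ^+ n * b = r ^+ n.+1 * b ^+ n.+1.
  by rewrite -mulrA -exprSr.
split; first by rewrite [in RHS]bN; ring.
exists n.+2; rewrite exprMn exprS [b ^+ n.+2]exprS.
transitivity ((1 - r ^+ n.+1 * b ^+ n.+1) ^+ n.+1 * b *
  (b ^+ n.+1 - r ^+ n.+1 * b ^+ n.+1 * b ^+ n.+1)); first by ring.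
by rewrite -bN subrr mulr0.
Qed.

Lemma artinian_splitting (R : comNzRingType) :
  artinian R -> forall b : R, idempotent_splitting b.
Proof.
move=> artR b.
have [|n|N stab] := artR (fun n => principal_ideal (b ^+ n)).
- by move=> n; apply: ideal_principal.
- by move=> _ [r _ <-]; exists (r * b); rewrite // exprS mulrA.
have := principal_ideal_refl (b ^+ N).
rewrite -(stab N.+1) // => -[r _ bN].
exact: (@pi_regular_splitting _ _ r N).
Qed.

Section AssociateToPolynomial.
Variable R : comNzRingType.
Implicit Types (f : fps R) (e : R).

Local Notation C := (@fps_const R).

(* On the summand cut out by the idempotent attached to f_k, the series f
   becomes regular of degree k; on the other one, f_k becomes nilpotent. *)
Lemma associate_poly_split f N (r : nat -> R) :
    (forall b : R, idempotent_splitting b) ->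
    \sum_(i < N) r i * fps_coef f i = 1 ->
  forall d e, e * e = e ->
    (forall i, (i < N - d)%N -> nilpotent (e * fps_coef f i)) ->
  exists u v p, u * v = 1 /\ C e * f = C e * u * fps_of_poly p.
Proof.
move=> splitR f1; elim=> [|d IHd] e ee nilf.
  (* All [e * f_i] with [i < N] are nilpotent here, hence so is their combination [e]. *)
  suff -> : e = 0.
    have -> : C 0 = 0 by apply: fpsP => i; rewrite fps_coefC; case: eqP.
    by exists 1, 1, 0; rewrite !mul0r mulr1.
  apply: nilpotent_idem_eq0 => //; rewrite -[e]mulr1 -f1 mulr_sumr.
  apply: nilpotent_sum => i; rewrite mulrCA; apply/nilpotentM/nilf.
  by rewrite subn0.
have [leNd|ltdN] := leqP N d.
  by apply: (IHd e) => // i; rewrite (eqP leNd).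
pose k := (N - d.+1)%N.
have def_k : (N - d)%N = k.+1 by rewrite /k subnSK.
have [s [idem nil_k]] := splitR (fps_coef f k).
pose e' := s * fps_coef f k; pose e1 := e * e'; pose e2 := e * (1 - e').
have e'e' : e' * e' = e' := idem.
have e1e1 : e1 * e1 = e1 by rewrite /e1 mulrACA ee e'e'.
have e1e2 : e1 * e2 = 0.
  by rewrite /e1 /e2 mulrACA mulrBr mulr1 e'e' subrr mulr0.
have e2e2 : e2 * e2 = e2.
  rewrite /e2 mulrACA ee; congr (_ * _).
  by rewrite mulrBl mul1r mulrBr mulr1 e'e' subrr subr0.
have defe : e = e1 + e2 by rewrite /e1 /e2; ring.
have [u2 [v2 [p2 [u2v2 fp2]]]] : exists u v p,
    u * v = 1 /\ C e2 * f = C e2 * u * fps_of_poly p.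
  apply: IHd => // i; rewrite def_k ltnS leq_eqVlt => /predU1P[->|ltik].
    by rewrite /e2 -mulrA; apply: nilpotentM.
  by rewrite /e2 mulrAC mulrC; apply/nilpotentM/nilf.
have [u1 [v1 [p1 [u1v1 fp1]]]] : exists u v p,
    u * v = 1 /\ C e1 * f = C e1 * u * fps_of_poly p.
  (* Putting [x^k] on the complementary summand makes the coefficient of degree [k] a unit of all of
     [R], the lower ones staying nilpotent. *)
  pose g := C e1 * f + C (1 - e1) * fps_of_poly 'X^k.
  have gi i : fps_coef g i = e1 * fps_coef f i + (1 - e1) * (i == k)%:R.
    by rewrite fps_coefD !fps_coefCM /= coefXn.
  have [i ltik||u [v [p [uv gp]]]] := @weierstrass_preparation _ g k.
  - rewrite gi (ltn_eqF ltik) mulr0 addr0 /e1 mulrAC mulrC.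
    exact/nilpotentM/nilf.
  - exists (e1 * s + (1 - e1)); rewrite gi eqxx mulr1.
    transitivity (e1 * e1 * e' + (1 - e1) +
      (e1 * e1 - e1) * (1 - s - fps_coef f k)); first by rewrite /e'; ring.
    by rewrite e1e1 subrr mul0r addr0 {1}/e1 -mulrA e'e' addrC subrK.
  exists u, v, p; split=> //; rewrite -mulrA -gp /g mulrDr !mulrA -!fps_constM.
  rewrite e1e1 mulrBr mulr1 e1e1 subrr.
  have -> : C 0 = 0 by apply: fpsP => i; rewrite fps_coefC; case: eqP.
  by rewrite mul0r addr0.
pose E1 := C e1; pose E2 := C e2.
have E1E1 : E1 * E1 = E1 by rewrite -fps_constM e1e1.
have E2E2 : E2 * E2 = E2 by rewrite -fps_constM e2e2.
have E1E2 : E1 * E2 = 0.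
  rewrite -fps_constM e1e2.
  by apply: fpsP => i; rewrite fps_coefC; case: eqP.
exists (E1 * u1 + (1 - E1) * u2), (E1 * v1 + (1 - E1) * v2).
exists (e1 *: p1 + e2 *: p2).
split.
  transitivity (E1 * E1 * (u1 * v1 + u2 * v2) + (1 - 2 * E1) * (u2 * v2) +
    (E1 - E1 * E1) * (u1 * v2 + u2 * v1)); first by ring.
  by rewrite E1E1 u1v1 u2v2; ring.
rewrite fps_of_polyZD defe fps_constD [LHS]mulrDl fp1 fp2 -/E1 -/E2.
set P1 := fps_of_poly p1; set P2 := fps_of_poly p2.
have -> : (E1 + E2) * (E1 * u1 + (1 - E1) * u2) = E1 * u1 + E2 * u2.
  transitivity (E1 * E1 * u1 + (E1 - E1 * E1) * u2 + E1 * E2 * (u1 - u2) +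
    E2 * u2); first by ring.
  by rewrite E1E2 E1E1 subrr !mul0r !addr0.
transitivity (E1 * E1 * u1 * P1 + E2 * E2 * u2 * P2 +
  E1 * E2 * (u1 * P2 + u2 * P1)); last by ring.
by rewrite E1E1 E2E2 E1E2 mul0r addr0.
Qed.

Lemma associate_poly_of_content1 f N (r : nat -> R) :
    (forall b : R, idempotent_splitting b) ->
    \sum_(i < N) r i * fps_coef f i = 1 ->
  exists u v p, u * v = 1 /\ f = u * fps_of_poly p.
Proof.
move=> splitR f1.
have [|i|u [v [p [uv fp]]]] :=
    @associate_poly_split f N r splitR f1 N 1; rewrite ?mulr1 ?subnn //.
by exists u, v, p; rewrite fps_const1 !mul1r in fp *.
Qed.

(* If f_i = c b_i and c = \sum_i r_i f_i then c = c s with s = \sum_i r_i b_i,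
   so that the b_i may be replaced by s b_i and b_N even by s b_N + 1 - s. *)
Lemma content_factorization f :
    principal_ideal_ring R ->
  exists c g N (r : nat -> R),
    f = C c * g /\ \sum_(i < N) r i * fps_coef g i = 1.
Proof.
move=> pirR.
pose J y := exists N (r : nat -> R), y = \sum_(i < N) r i * fps_coef f i.
have widen N M (r : nat -> R) : (N <= M)%N -> exists r' : nat -> R,
    \sum_(i < N) r i * fps_coef f i = \sum_(i < M) r' i * fps_coef f i.
  move=> leNM; exists (fun i => if (i < N)%N then r i else 0).
  rewrite (big_ord_widen _ (fun i => r i * fps_coef f i) leNM) big_mkcond.
  by apply: eq_bigr => i _; case: ifP; rewrite ?mul0r.
have [|c Jc] := pirR J.
  split=> [|a b [N [r ->]] [M [s ->]]|a b [N [r ->]]].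
  - by exists 0%N, (fun=> 0); rewrite big_ord0.
  - have [r' ->] := widen _ _ r (leq_maxl N M).
    have [s' ->] := widen _ _ s (leq_maxr N M).
    exists (maxn N M), (fun i => r' i + s' i); rewrite -big_split.
    by apply: eq_bigr => i _; rewrite mulrDl.
  - exists N, (fun i => a * r i); rewrite mulr_sumr.
    by apply: eq_bigr => i _; rewrite mulrA.
have /choice[b fb] : forall i, exists b, fps_coef f i = c * b.
  move=> i; have : J (fps_coef f i).
    exists i.+1, (fun j => (j == i)%:R).
    rewrite big_ord_recr /= eqxx mul1r big1 ?add0r // => j _.
    by rewrite (ltn_eqF (ltn_ord j)) mul0r.
  by rewrite Jc => -[b _ <-]; exists b; rewrite mulrC.
have : J c by rewrite Jc; apply: principal_ideal_refl.
case=> N [r defc]; pose s := \sum_(i < N) r i * b i.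
have cs : c * (1 - s) = 0.
  rewrite mulrBr mulr1 {1}defc /s mulr_sumr; apply/eqP; rewrite subr_eq0.
  by apply/eqP/eq_bigr => i _; rewrite fb mulrCA.
exists c, (FPS (fun i => s * b i + (if i == N then 1 - s else 0))), N.+1.
(* With [t = b N], the sum becomes [s^2 (1 - t)^2 + (1 + s (1 - t)) (1 - s (1 - t)) = 1]. *)
exists (fun i => if i == N then 1 + s * (1 - b N) else (1 - b N) ^+ 2 * r i).
split.
  apply: fpsP => i; rewrite fps_coefCM fb /= mulrDr.
  have -> : c * (if i == N then 1 - s else 0) = 0.
    by case: eqP; rewrite ?mulr0.
  have := cs; rewrite mulrBr mulr1 => /eqP; rewrite subr_eq0 => /eqP {1}->.
  by rewrite addr0 mulrA.
rewrite big_ord_recr /= eqxx.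
transitivity ((1 - b N) ^+ 2 * s * s +
  (1 + s * (1 - b N)) * (s * b N + (1 - s))); last by ring.
congr (_ + _); rewrite /s mulr_sumr; apply: eq_bigr => i _.
by rewrite (ltn_eqF (ltn_ord i)) addr0; ring.
Qed.

Lemma artinian_pir_associate_poly f :
  artinian_pir R -> exists p : {poly R}, associate f (fps_of_poly p).
Proof.
case=> artR pirR.
have [c [g [N [r [-> g1]]]]] := content_factorization f pirR.
have [u [v [p [uv ->]]]] :=
  associate_poly_of_content1 (artinian_splitting artR) g1.
exists (c *: p), u; last by rewrite fps_of_polyZ mulrCA.
by apply/asboolP; exists v; rewrite mulrC.
Qed.

End AssociateToPolynomial.

(** * Uncountably many associate classes *)

Section Uncountable.
Variable R : comNzRingType.
Implicit Types (f g : fps R) (I : set R).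

Local Notation C := (@fps_const R).

(** Separation at the first index where two sequences differ makes their classes distinct,
    association being symmetric; Cantor's diagonal argument concludes. *)
Lemma uncountable_classes (F : (nat -> bool) -> fps R) :
    (forall (D E : nat -> bool) n u, (forall i, (i < n)%N -> D i = E i) ->
      D n -> ~~ E n -> F D <> u * F E) ->
  ~ countable (range (fun D => associate_class (F D))).
Proof.
move=> sepF /countable_injP[c injc].
pose cl D := associate_class (F D).
have clF D : cl D (F D) by exists 1; [exact: unitr1|rewrite mul1r].
have injcl D E : cl D = cl E -> D = E.
  move=> eqDE; apply/funext => i; apply/eqP/negPn/negP => neDE.
  have ex_ne : exists i, D i != E i by exists i.
  case: (ex_minnP ex_ne) => n neDEn min_n {i neDE ex_ne}.
  have eq_lt i : (i < n)%N -> D i = E i.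
    by move=> ltin; apply/eqP; apply: contraTT ltin => /min_n; rewrite -leqNgt.
  have [u _ FD] : cl E (F D) by rewrite -eqDE.
  have [v _ FE] : cl D (F E) by rewrite eqDE.
  case Dn: (D n) neDEn => // neDEn.
    by apply: (sepF D E n u) => //; case: (E n) neDEn.
  apply: (sepF E D n v) => // [i /eq_lt //||]; last by rewrite Dn.
  by case: (E n) neDEn.
pose D n := ~~ `[< exists2 E, c (cl E) = n & E n >].
suff : D (c (cl D)) <-> ~ D (c (cl D)) by case: (D _); intuition.
split=> [/asboolPn nex Dc|nDc]; first by apply: nex; exists D.
apply/asboolPn => -[E cE En]; apply: nDc.
suff {1}-> : D = E by [].
by apply/injcl/injc; rewrite ?inE; [exists D|exists E|].
Qed.

Lemma uncountable_of_separated (F : (nat -> bool) -> fps R) :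
    (forall (D E : nat -> bool) n u, (forall i, (i < n)%N -> D i = E i) ->
      D n -> ~~ E n -> F D <> u * F E) ->
  exists S, S `<=` associate_classes (fps R) /\ ~ countable S.
Proof.
move=> /uncountable_classes nc; exists (range (fun D => associate_class (F D))).
by split=> // _ [D _ <-]; exists (F D).
Qed.

Definition infinite_ascent : Prop := exists (I : nat -> set R) (a : nat -> R),
  [/\ forall n, ideal (I n), forall n, I n `<=` I n.+1
    & forall n, I n.+1 (a n) /\ ~ I n (a n)].

Lemma ideal_sum I n (F : 'I_n -> R) :
  ideal I -> (forall i, I (F i)) -> I (\sum_i F i).
Proof. by case=> I0 ID _ IF; apply: big_ind. Qed.

Lemma idealN I a : ideal I -> I a -> I (- a).
Proof. by case=> _ _ IM Ia; rewrite -mulN1r; apply: IM. Qed.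

Lemma uncountable_of_ascent :
  infinite_ascent ->
  exists S, S `<=` associate_classes (fps R) /\ ~ countable S.
Proof.
case=> I [a [idI incI Ia]].
have homI m n : (m <= n)%N -> I m `<=` I n.
  move=> /subnK <-; elim: (n - m)%N => // d IHd x /IHd.
  by rewrite addSn; apply: incI.
apply: (uncountable_of_separated
  (F := fun D => FPS (fun i => if D i then a i else 0))).
move=> D E n u eqDE Dn En /(congr1 (fun f => fps_coef f n)).
rewrite fps_coefM /= Dn => def_an; case: (Ia n) => _; apply; rewrite def_an.
(* Since [E n] is false, only [a_m] with [m < n] occur, and these lie in [I m.+1], inside [I n]. *)
have [I0 _ IM] := idI n; apply: ideal_sum => // j; apply: (IM).
case: ifP => // Enj; apply: (homI (n - j).+1 n) (proj1 (Ia _)).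
rewrite ltn_neqAle leq_subr andbT; apply: contraNneq En => <-.
by rewrite Enj.
Qed.

(* The series a + b s, with s having coefficients 0 and 1, are pairwise not
   associate as soon as the ideal (b : a) + (a : b) is proper. *)
Lemma uncountable_of_two_generators (a b : R) :
    (forall r s x y, r * a = x * b -> s * b = y * a -> r + s <> 1) ->
  exists S, S `<=` associate_classes (fps R) /\ ~ countable S.
Proof.
move=> proper.
pose s (D : nat -> bool) : fps R := FPS (fun i => (D i)%:R).
apply: (uncountable_of_separated (F := fun D => C a + C b * s D)).
move=> D E n u eqDE Dn En eqF.
(* [M] is [(b : a) + (a : b)]. The coefficients of [1 - u] lie in the first summand, those of
   [u * s E - s D] in the second. *)
pose M z := exists r t x y,
  [/\ z = r + t, r * a = x * b & t * b = y * a].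
have idM : ideal M.
  split=> [|_ _ [r [t [x [y [-> ra tb]]]]] [r' [t' [x' [y' [-> ra' tb']]]]]|].
  - by exists 0, 0, 0, 0; rewrite addr0 !mul0r.
  - exists (r + r'), (t + t'), (x + x'), (y + y').
    by rewrite !mulrDl ra tb ra' tb' addrACA.
  move=> z _ [r [t [x [y [-> ra tb]]]]].
  exists (z * r), (z * t), (z * x), (z * y).
  by rewrite mulrDr -!mulrA ra tb.
have nM1 : ~ M 1.
  by case=> r [t [x [y [/esym rt1 ra tb]]]]; apply: (proper r t x y).
have Mu i : M (fps_coef (1 - u) i).
  exists (fps_coef (1 - u) i), 0, (fps_coef (u * s E - s D) i), 0.
  split; rewrite ?addr0 ?mul0r // [LHS]mulrC [RHS]mulrC -!fps_coefCM.
  congr fps_coef; transitivity (C a + C b * s D - C b * s D - u * C a).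
    by ring.
  by rewrite eqF; ring.
have Ms i : M (fps_coef (u * s E - s D) i).
  exists 0, (fps_coef (u * s E - s D) i), 0, (fps_coef (1 - u) i).
  split; rewrite ?add0r ?mul0r // [LHS]mulrC [RHS]mulrC -!fps_coefCM.
  congr fps_coef; transitivity (C a + C b * (u * s E) - C a - C b * s D).
    by ring.
  transitivity (u * (C a + C b * s E) - u * C a + C a - (C a + C b * s D)).
    by ring.
  by rewrite -eqF; ring.
have [_ MD MM] := idM; apply: nM1.
have -> : 1 = - (fps_coef ((1 - u) * s E) n + fps_coef (u * s E - s D) n).
  rewrite -fps_coefD -fps_coefN.
  have -> : - ((1 - u) * s E + (u * s E - s D)) = s D - s E by ring.
  by rewrite fps_coefD fps_coefN /= Dn (negbTE En) subr0.
apply: idealN => //; apply: (MD) => //; rewrite mulrC fps_coefM.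
by apply: ideal_sum => // j; apply: MM.
Qed.

(* The series t - x s, with s having coefficients 0 and 1, are pairwise not
   associate as soon as t is neither a unit nor a zero divisor modulo I. *)
Lemma uncountable_of_regular (I : set R) (t : R) :
    ideal I -> (forall r, I (r * t) -> I r) ->
    (forall i r, I i -> i + r * t <> 1) ->
  exists S, S `<=` associate_classes (fps R) /\ ~ countable S.
Proof.
move=> idI regt propert; have [I0 ID IM] := idI.
pose s (D : nat -> bool) : fps R :=
  FPS (fun i => if i is j.+1 then (D j)%:R else 0).
apply: (uncountable_of_separated (F := fun D => C t - s D)).
move=> D E n u eqDE Dn En eqF.
pose w := u - 1.
have eqw : C t * w = w * s E + (s E - s D).
  transitivity (u * (C t - s E) - C t + u * s E); first by rewrite /w; ring.
  by rewrite -eqF /w; ring.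
have coefw i : fps_coef w i * t = fps_coef (w * s E) i + fps_coef (s E - s D) i.
  by rewrite mulrC -fps_coefCM eqw.
have Iws i : (forall j, (j < i)%N -> I (fps_coef w j)) ->
    I (fps_coef (w * s E) i).
  move=> Iw; rewrite fps_coefM big_ord_recr /= subnn mulr0 addr0.
  by apply: ideal_sum => // j; rewrite mulrC; apply/IM/Iw.
(* Up to degree [n] the series [s D] and [s E] agree, so regularity of [t] puts [w_i] in [I]
   inductively. In degree [n.+1] their difference makes [t] a unit modulo [I]. *)
have Iw i : (i <= n)%N -> I (fps_coef w i).
  elim/ltn_ind: i => i IHi lein; apply: regt; rewrite coefw.
  have -> : fps_coef (s E - s D) i = 0.
    rewrite fps_coefD fps_coefN /=; case: i lein {IHi} => [|i] ltin.
      by rewrite subr0.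
    by rewrite eqDE // subrr.
  rewrite addr0; apply: Iws => j ltji; apply: IHi => //.
  exact: ltnW (leq_trans ltji lein).
apply: (propert (fps_coef (w * s E) n.+1) (- fps_coef w n.+1)).
  exact: Iws.
rewrite mulNr coefw.
have -> : fps_coef (s E - s D) n.+1 = - 1.
  by rewrite fps_coefD fps_coefN /= Dn (negbTE En) add0r.
by ring.
Qed.

End Uncountable.

(** * Rings without such series *)

Section Converse.
Variable R : comNzRingType.
Implicit Types (I J : set R) (t : R).

(** Without a maximal member, choice yields an infinite strictly increasing sequence of ideals in
    [P]. *)
Lemma noetherian_maximal (P : set R -> Prop) I0 :
    ~ infinite_ascent R -> (forall I, P I -> ideal I) -> P I0 ->
  exists2 M, P M & forall J, P J -> M `<=` J -> J `<=` M.
Proof.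
move=> noeth idP PI0; apply: contrapT => nomax.
have next (I : {I | P I}) : exists Ja : {I | P I} * R,
    [/\ sval I `<=` sval Ja.1, sval Ja.1 Ja.2 & ~ sval I Ja.2].
  apply: contrapT => nonext; apply: nomax.
  exists (sval I); [exact: svalP|move=> J PJ leIJ a Ja; apply: contrapT => nIa].
  by apply: nonext; exists (exist _ J PJ, a).
have [step stepP] := choice next.
pose chain n := iter n (fun X => (step X).1) (exist P I0 PI0).
apply: noeth; exists (fun n => sval (chain n)), (fun n => (step (chain n)).2).
by split=> n; [exact/idP/svalP|have [] := stepP (chain n)|
  have [] := stepP (chain n)].
Qed.

Definition colon I t : set R := [set r | I (r * t)].

Definition adjoin I t : set R :=
  [set y | exists2 i, I i & exists r, y = i + r * t].

Lemma ideal_colon I t : ideal I -> ideal (colon I t).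
Proof.
case=> I0 ID IM; split=> [|a b|r a]; rewrite /colon /= ?mul0r ?mulrDl -?mulrA.
- exact: I0.
- exact: ID.
- exact: IM.
Qed.

Lemma ideal_adjoin I t : ideal I -> ideal (adjoin I t).
Proof.
case=> I0 ID IM; split=> [|_ _ [i Ii [r ->]] [j Ij [s ->]]|a _ [i Ii [r ->]]].
- by exists 0 => //; exists 0; rewrite mul0r addr0.
- by exists (i + j); [apply: ID|exists (r + s); rewrite mulrDl addrACA].
- by exists (a * i); [apply: IM|exists (a * r); rewrite mulrDr mulrA].
Qed.


Lemma ideal_set0 : ideal [set 0 : R].
Proof.
by split=> [|a b -> ->|r a ->] //=; rewrite ?addr0 ?mulr0.
Qed.

Definition regular_elements_trivial : Prop :=
  forall I t, ideal I -> (forall r, I (r * t) -> I r) ->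
  exists i r, I i /\ i + r * t = 1.

(** In each localization at a maximal ideal, [r] or [s] is a unit, so one of [a] and [b] divides the
    other. *)
Definition pairs_locally_principal : Prop :=
  forall a b : R, exists r s x y,
  [/\ r * a = x * b, s * b = y * a & r + s = 1].

(** If [(0 : b^n)] is maximal among such annihilators, [b] is regular modulo it, hence a unit:
    [i + r * b = 1] with [i * b^n = 0]. Multiplying by [b^n] gives pi-regularity. *)
Lemma noetherian_splitting (b : R) :
  ~ infinite_ascent R -> regular_elements_trivial -> idempotent_splitting b.
Proof.
move=> noeth noreg; pose Z n := colon [set 0] (b ^+ n).
have [_ /= [n ->] maxZ] : exists2 M, (exists n, M = Z n) &
    forall J, (exists n, J = Z n) -> M `<=` J -> J `<=` M.
  apply: (@noetherian_maximal _ (Z 0%N)) => // [_ [n ->]|]; last by exists 0%N.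
  exact/ideal_colon/ideal_set0.
have [|r|i [r [ibn0 irb]]] := noreg (Z n) b.
- exact/ideal_colon/ideal_set0.
- move=> rb; apply: (maxZ (Z n.+1)); first by exists n.+1.
    by move=> x xbn0; rewrite /Z /colon /= exprSr mulrA xbn0 mul0r.
  by rewrite /Z /colon /= exprS mulrA.
apply: (@pi_regular_splitting _ _ r n).
by rewrite -[LHS]mul1r -irb mulrDl ibn0 add0r exprS mulrA.
Qed.

(** Let [e] be the idempotent attached to [r]. On [eR], [r] is a unit and [a] is a multiple of [b];
    on [(1 - e)R], [r] is nilpotent, so [s = 1 - r] is a unit and [b] is a multiple of [a]. Hence
    the generator [(1 - e) * a + e * b]. *)
Lemma principal_pair (a b : R) :
    (forall c : R, idempotent_splitting c) -> pairs_locally_principal ->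
  exists g c d x y, [/\ g = c * a + d * b, a = x * g & b = y * g].
Proof.
move=> splitR locR; have [r [s [x [y [ra sb rs1]]]]] := locR a b.
have [z [idem nilr]] := splitR r; pose e := z * r.
have ee : e * e = e by [].
have [v ev] := subr1_nilpotent nilr; rewrite -/e in ev.
exists ((1 - e) * a + e * b), (1 - e), e.
exists (z * x * e + (1 - e)), (e + v * y * (1 - e)); split=> //.
- transitivity (z * (r * a) * e + (1 - e) * a + (1 - e * e - (1 - e)) * 0).
    rewrite mulr0 addr0.
    transitivity (e * e * a + (1 - e) * a); first by rewrite ee; ring.
    by rewrite /e; ring.
  rewrite ra mulr0 addr0.
  transitivity (z * x * (e * e) * b + (1 - 2 * e + e * e) * a +
    (e - e * e) * (z * x * a + b)); last by ring.
  by rewrite ee; ring.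
- have eb : (1 - e) * b = (1 - e) * (v * y * a).
    transitivity ((1 - e) * (1 - (1 - e) * r) * v * b).
      by rewrite -[_ * _ * v]mulrA ev mulr1.
    transitivity ((1 - e) * v * (s * b) + (e - e * e) * r * v * b).
      by have -> : s = 1 - r by [rewrite -rs1; ring]; ring.
    by rewrite ee subrr !mul0r addr0 sb; ring.
  transitivity (e * b + (1 - e) * b); first by ring.
  rewrite eb.
  transitivity (e * e * b + v * y * (1 - 2 * e + e * e) * a +
    (e - e * e) * (a + v * y * b)); last by ring.
  by rewrite ee; ring.
Qed.

(** A maximal principal ideal inside [J] contains every [b] in [J], since adjoining [b] gives again
    a principal ideal inside [J]. *)
Lemma noetherian_pir :
    ~ infinite_ascent R -> regular_elements_trivial ->
    pairs_locally_principal ->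
  principal_ideal_ring R.
Proof.
move=> noeth noreg locR J idJ; have [J0 JD JM] := idJ.
have splitR c := noetherian_splitting c noeth noreg.
pose P K := exists2 g, J g & K = principal_ideal g.
have [||_ [g Jg ->] maxg] := @noetherian_maximal P (principal_ideal 0) noeth.
- by move=> _ [g _ ->]; apply: ideal_principal.
- by exists 0.
exists g; apply/seteqP; split=> [b Jb|_ [r _ <-]]; last exact: JM.
have [h [c [d [x [y [defh defg defb]]]]]] := principal_pair g b splitR locR.
have [_ _ gM] := ideal_principal g.
rewrite defb; apply: gM; apply: (maxg (principal_ideal h)).
- by exists h => //; rewrite defh; apply: JD; apply: JM.
- by move=> _ [r _ <-]; exists (r * x); rewrite // -mulrA -defg.
- exact: principal_ideal_refl.
Qed.

Definition descending (K : nat -> set R) : Prop :=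
  (forall n, ideal (K n)) /\ (forall n, K n.+1 `<=` K n).

Definition stationary (K : nat -> set R) : Prop :=
  exists N, forall n, (N <= n)%N -> K n = K N.

Lemma descending_homo K m n : descending K -> (m <= n)%N -> K n `<=` K m.
Proof.
move=> [_ decK] /subnK <-; elim: (n - m)%N => // d IHd x.
by rewrite addSn => /decK/IHd.
Qed.

(* An ideal I maximal among those below a non-stationary chain would be prime,
   through the exact sequence 0 -> R/(I : t) -> R/I -> R/(I + Rt) -> 0. *)
Lemma noetherian_artinian :
  ~ infinite_ascent R -> regular_elements_trivial -> artinian R.
Proof.
move=> noeth noreg K0 idK0 decK0; apply: contrapT => nstatK0.
pose bad I := ideal I /\ exists K,
  [/\ descending K, forall n, I `<=` K n & ~ stationary K].
have [||I [idI [K [descK leIK nstatK]]] maxI] :=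
    @noetherian_maximal bad [set 0] noeth.
- by move=> I [].
- split; first exact: ideal_set0.
  by exists K0; split=> // n _ ->; have [] := idK0 n.
have stat J L : ideal J -> I `<=` J -> ~ J `<=` I -> descending L ->
    (forall n, J `<=` L n) -> stationary L.
  move=> idJ leIJ nleJI descL leJL; apply: contrapT => nstatL.
  by apply: nleJI; apply: maxI => //; split=> //; exists L.
have [idK decK] := descK; have [I0 ID IM] := idI.
(* Otherwise the terms are all [R], or all [I] from some point on, and the chain is stationary. *)
have [m [t [Kt nIt nK1]]] : exists m t, [/\ K m t, ~ I t & ~ K m 1].
  apply: contrapT => nKt; apply: nstatK.
  have KI m : ~ K m 1 -> K m = I.
    move=> nK1; apply/seteqP; split=> [t Kt|]; last exact: leIK.
    by apply: contrapT => nIt; apply: nKt; exists m, t.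
  have [[m nK1]|allK1] := pselect (exists m, ~ K m 1).
    exists m => n lemn; rewrite (KI m nK1); apply: KI.
    by move/(descending_homo descK lemn).
  have KT n : K n = setT.
    apply/seteqP; split=> // x _; have [_ _ KM] := idK n.
    rewrite -[x]mulr1; apply: KM; apply: contrapT => nK1.
    by apply: allK1; exists n.
  by exists 0%N => n _; rewrite (KT n) (KT 0%N).
have [_ KmD KmM] := idK m.
have [Na stata] : stationary (fun n => adjoin (K n) t).
  apply: (stat (adjoin I t)).
  - exact: ideal_adjoin.
  - by move=> x Ix; exists x => //; exists 0; rewrite mul0r addr0.
  - move=> leI; apply/nIt/leI; exists 0 => //.
    by exists 1; rewrite mul1r add0r.
  - split=> n; first exact: ideal_adjoin.
    by move=> _ [i /decK Ki [r ->]]; exists i => //; exists r.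
  - by move=> n _ [i /leIK Ki [r ->]]; exists i => //; exists r.
have [Nc statc] : stationary (fun n => colon (K n) t).
  apply: (stat (colon I t)).
  - exact: ideal_colon.
  - by move=> x Ix; rewrite /colon /= mulrC; apply: IM.
  (* Here [t] is regular modulo [I], hence a unit there, yet it lies in the proper ideal [K m]. *)
  - move=> regt; have [i [r [Ii irt]]] := noreg I t idI regt.
    by apply: nK1; rewrite -irt; apply: KmD; [apply: leIK|apply: KmM].
  - by split=> n; [apply: ideal_colon|move=> x; apply: decK].
  - by move=> n x; apply: leIK.
(* Once both chains are constant, write [y] in [K N] as [z + r * t] with [z] in [K n]; then [r] lies
   in [(K N : t) = (K n : t)], so [y] lies in [K n]. *)
apply: nstatK; exists (maxn Na Nc) => n leNn; set N := maxn Na Nc in leNn *.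
have leKnN : K n `<=` K N by apply: descending_homo.
apply/seteqP; split=> // y KNy.
have : adjoin (K n) t y.
  rewrite stata ?(leq_trans (leq_maxl _ _) leNn) // -(stata N) ?leq_maxl //.
  by exists y => //; exists 0; rewrite mul0r addr0.
case=> z Knz [r def_y]; have [_ KnD _] := idK n; rewrite def_y.
apply: KnD => //.
suff : colon (K n) t r by [].
rewrite statc ?(leq_trans (leq_maxr _ _) leNn) // -(statc N) ?leq_maxr //.
have [_ KND _] := idK N; rewrite /colon /=.
have -> : r * t = y + - z by rewrite def_y; ring.
by apply: KND => //; apply: idealN => //; apply: leKnN.
Qed.

End Converse.

(** * Assembly of the cases and removal of the classes of polynomials *)

Theorem proposition4p1 (R : comNzRingType) :
  [/\ (* (i) *)
      ~ artinian_pir R ->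
      exists S : set (set (fps R)),
        S `<=` associate_classes (fps R) /\ ~ countable S,
      (* (ii) *)
      countable [set: R] -> ~ artinian_pir R ->
      exists S : set (set (fps R)),
        [/\ S `<=` associate_classes (fps R), ~ countable S
          & forall C, S C -> forall p : {poly R}, ~ C (fps_of_poly p)]
    & (* (iii) *)
      artinian_pir R ->
      forall f : fps R, exists p : {poly R}, associate f (fps_of_poly p)].
Proof.
have partI : ~ artinian_pir R -> exists S : set (set (fps R)),
    S `<=` associate_classes (fps R) /\ ~ countable S.
  move=> nR; apply: contrapT => few.
  have noeth : ~ infinite_ascent R by move/uncountable_of_ascent.
  have noreg : regular_elements_trivial R.
    move=> I t idI regt; apply: contrapT => proper; apply: few.
    apply: (@uncountable_of_regular _ I t) => // i r Ii irt.
    by apply: proper; exists i, r.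
  apply: nR; split; first exact: noetherian_artinian.
  apply: noetherian_pir => // a b; apply: contrapT => proper; apply: few.
  apply: (@uncountable_of_two_generators _ a b) => r s x y ra sb rs.
  by apply: proper; exists r, s, x, y.
split=> // [cntR /partI[S [Scl ncS]]|artR f]; last first.
  exact: artinian_pir_associate_poly.
(* [T] is countable because [R[x]] is, so discarding it leaves uncountably many classes. *)
pose T := range (fun p : {poly R} => associate_class (fps_of_poly p)).
exists (S `\` T); split=> [C [/Scl]||] //.
  move=> cntST; apply: ncS.
  have cntpoly : countable [set: {poly R}].
    have /countable_injP[c injc] := cntR; apply/countable_injP.
    exists (fun p : {poly R} => pickle (map c p)) => p q _ _ /=.
    move=> /(pcan_inj pickleK) /inj_map eqpq; apply/val_inj/eqpq.
    by move=> x y; apply: injc; rewrite inE.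
  have cntT : countable T by apply: sub_countable (card_image_le _ _) cntpoly.
  move: cntST cntT => /countable_injP[c injc] /countable_injP[d injd].
  apply/countable_injP.
  (* Even codes for classes in [T], odd codes for the others. *)
  exists (fun C => if C \in T then (d C).*2 else (c C).*2.+1).
  move=> C D SC SD; case: ifPn => CT; case: ifPn => DT.
  - by move/double_inj; apply: injd.
  - by move/(congr1 odd); rewrite /= !odd_double.
  - by move/(congr1 odd); rewrite /= !odd_double.
  - case=> /double_inj; apply: injc; apply/mem_set; split; try exact/set_mem.
      by move/mem_set; apply/negP.
    by move/mem_set; apply/negP.
move=> C [/Scl[f _ <-] nT] p [u Uu uf]; apply: nT; exists p => //.
apply/seteqP; split=> _ [v /= Uv <-].
  by exists (v * u); rewrite /= ?unitrM ?Uv // -uf mulrA.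
exists (v / u); first by rewrite /= unitrM Uv unitrV.
by rewrite -uf mulrA divrK.
Qed.
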